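(* For any $w,p_0,p_1,p_2\in\mathbb Z$, $\ell\in\mathbb Z_{>0}$ and $u\in\mathbb Z_{\ge0}$, the following identity holds: $$G(w,u,\ell;p_0,p_1,p_2)=0.$$
   Context: $q$ is an indeterminate. For $n,d\in\mathbb Z$: $[n]=\frac{q^n-q^{-n}}{q-q^{-1}}$, $[m]!=[1][2]\cdots[m]$, and $\begin{bmatrix}n\\d\end{bmatrix}_q=\frac{[n][n-1]\cdots[n-d+1]}{[d]!}$ if $d\ge0$, and $0$ if $d<0$ ($n$ may be negative). $\begin{bmatrix}n\\d\end{bmatrix}_{q^2}$ is obtained by replacing $q$ by $q^2$. For $w,p_0,p_1,p_2\in\mathbb Z$ and $u,\ell\in\mathbb Z_{\ge0}$ define $$\begin{aligned}G(w,u,\ell;p_0,p_1,p_2)=(-1)^wq^{u^2-wu+\ell u}\Big\{&\sum_{\substack{c,e,r\ge0\\c+e+r=u}}\ \sum_{\substack{t=0\\2\mid(t+w-r)}}^{\ell}q^{-t(\ell+u-1)-u(c+e)+2c+rp_0+2cp_1+2ep_2}\begin{bmatrix}\ell\\t\end{bmatrix}_q\begin{bmatrix}w+t+p_0\\ r\end{bmatrix}_q\begin{bmatrix}\frac{w+t-r}2+p_1\\c\end{bmatrix}_{q^2}\begin{bmatrix}\frac{w+t-r}2+p_2\\ e\end{bmatrix}_{q^2}\\&-\sum_{\substack{c,e,r\ge0\\c+e+r=u}}\ \sum_{\substack{t=0\\2\nmid(t+w-r)}}^{\ell}q^{-t(\ell+u-1)-(u-1)(c+e)+rp_0+2cp_1+2ep_2}\begin{bmatrix}\ell\\t\end{bmatrix}_q\begin{bmatrix}w+t+p_0\\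 r\end{bmatrix}_q\begin{bmatrix}1+\frac{w+t-r-1}2+p_1\\c\end{bmatrix}_{q^2}\begin{bmatrix}\frac{w+t-r-1}2+p_2\\ e\end{bmatrix}_{q^2}\Big\}.\end{aligned}$$ *)

(* Defs.v *)
From mathcomp Require Import all_boot all_order all_algebra.

Set Implicit Arguments.
Unset Strict Implicit.
Unset Printing Implicit Defensive.

Import GRing.Theory.
Local Open Scope ring_scope.

(* The field Q(q) of rational functions over the rationals; the indeterminate
   q is q_ind. *)
Definition Qq : fieldType := {fraction {poly rat}}.
Definition q_ind : Qq := @tofrac {poly rat} 'X.

(* Quantum integers, factorials and binomials at a parameter v; they are used
   with v = q and with v = q^2. *)
Definition qint (v : Qq) (n : int) : Qq := (v ^ n - v ^ (- n)) / (v - v^-1).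

Definition qfact (v : Qq) (m : nat) : Qq :=
  \prod_(1 <= i < m.+1) qint v i%:Z.

Definition qbinom (v : Qq) (n d : int) : Qq :=
  match d with
  | Posz m => (\prod_(0 <= i < m) qint v (n - i%:Z)) / qfact v m
  | Negz _ => 0
  end.

(* The divisions by 2 below are Euclidean (intdiv), and exact under the parity
   condition of the sum in which they occur. *)
Definition G (w : int) (u l : nat) (p0 p1 p2 : int) : Qq :=
  let q := q_ind in
  (-1) ^ w * q ^ (u%:Z ^+ 2 - w * u%:Z + l%:Z * u%:Z) *
  ((\sum_(c < u.+1) \sum_(e < u.+1) \sum_(r < u.+1 | (c + e + r == u)%N)
      \sum_(t < l.+1 | (2 %| t%:Z + w - r%:Z)%Z)
        q ^ (- t%:Z * (l%:Z + u%:Z - 1) - u%:Z * (c%:Z + e%:Z) + 2 * c%:Z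
             + r%:Z * p0 + 2 * c%:Z * p1 + 2 * e%:Z * p2)
        * qbinom q l%:Z t%:Z
        * qbinom q (w + t%:Z + p0) r%:Z
        * qbinom (q ^+ 2) (((w + t%:Z - r%:Z) %/ 2)%Z + p1) c%:Z
        * qbinom (q ^+ 2) (((w + t%:Z - r%:Z) %/ 2)%Z + p2) e%:Z)
   - \sum_(c < u.+1) \sum_(e < u.+1) \sum_(r < u.+1 | (c + e + r == u)%N)
      \sum_(t < l.+1 | ~~ (2 %| t%:Z + w - r%:Z)%Z)
        q ^ (- t%:Z * (l%:Z + u%:Z - 1) - (u%:Z - 1) * (c%:Z + e%:Z)
             + r%:Z * p0 + 2 * c%:Z * p1 + 2 * e%:Z * p2)
        * qbinom q l%:Z t%:Z
        * qbinom q (w + t%:Z + p0) r%:Z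
        * qbinom (q ^+ 2) (1 + ((w + t%:Z - r%:Z - 1) %/ 2)%Z + p1) c%:Z
        * qbinom (q ^+ 2) (((w + t%:Z - r%:Z - 1) %/ 2)%Z + p2) e%:Z).

(* Main.v *)
(* The parities combine into (-1)^t, and the t-dependence of G becomes
   (-1)^t q^(-t(l-1)) [l,t] H(w+t) with
     H(N) = q^(-2uN) sum_(r+s=u) (-1)^r q^(-s^2) A_r(N+p0) B_s(N-r),
     A_r(n) = q^(rn) [n,r],
   where B_s(M) is a convolution of two such A's at q^2, taken in the shape
   dictated by the parity of M.  The Pascal rule gives
     A_r(n+1) = q^(2r) (A_r(n) + q^-1 A_(r-1)(n)),
   and, for M of either parity, B_s(M+1) = q^(2s) (B_s(M) + B_(s-1)(M)).
   Substituting both into H(N+1), the extra terms cancel in pairs, so that H is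
   constant; and sum_t (-1)^t q^(-t(l-1)) [l,t] = 0 for l > 0. *)
Require Import Defs.
From mathcomp Require Import all_boot all_order all_algebra.
From mathcomp Require Import ring zify.

Import GRing.Theory.
Local Open Scope ring_scope.

(** * Quantum integers, the Pascal rule and the alternating sum *)

Definition generic (v : Qq) := forall n, (0 < n)%N -> v ^+ n != 1.

Lemma q_ind_neq0 : q_ind != 0.
Proof. by rewrite /q_ind -tofrac0 tofrac_eq polyX_eq0. Qed.

Lemma q_ind_generic : generic q_ind.
Proof.
move=> n n_gt0; rewrite /q_ind -rmorphXn -tofrac1 tofrac_eq.
apply/eqP => /(congr1 (fun p : {poly rat} => size p)).
by rewrite size_polyXn size_poly1 => -[] n0; rewrite n0 in n_gt0.
Qed.

(* Without this, unification unfolds the fraction field and does not return. *)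
Local Opaque Qq q_ind.

Lemma generic_expr v n : (0 < n)%N -> generic v -> generic (v ^+ n).
Proof. by move=> n_gt0 gv m m_gt0; rewrite -exprM gv // muln_gt0 n_gt0. Qed.

Lemma qint0 v : qint v 0 = 0.
Proof. by rewrite /qint oppr0 subrr mul0r. Qed.

Lemma qintS_neq0 v n : v != 0 -> generic v -> qint v n.+1%:Z != 0.
Proof.
move=> v0 gv.
have ne k : (0 < k)%N -> v ^ k%:Z - v ^ (- k%:Z) != 0.
  move=> k0; rewrite subr_eq0; apply/eqP => e.
  have := gv (k + k)%N; rewrite addn_gt0 k0 => /(_ isT) /eqP; apply.
  by rewrite exprD -[v ^+ k]/(v ^ k%:Z) {1}e -expfzDr // addNr expr0z.
by have := ne 1%N isT; rewrite exprN1 expr1z /qint => ?; rewrite mulf_neq0 ?invr_neq0 ?ne.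
Qed.

Lemma qfact_neq0 v n : v != 0 -> generic v -> qfact v n != 0.
Proof.
move=> v0 gv; rewrite /qfact big_add1 /=.
by rewrite prodf_seq_neq0; apply/allP => i _; exact: qintS_neq0.
Qed.

(** Over the common denominator the terms [v ^ (2r + 1 - n)] cancel. This splits the top factor
    [n+1] in the Pascal rule. *)
Lemma qint_succ v (n : int) (r : nat) : v != 0 ->
  qint v (n + 1) =
    v ^ r.+1%:Z * qint v (n - r%:Z) + v ^ (r%:Z - n) * qint v r.+1%:Z.
Proof.
move=> v0; rewrite /qint !mulrA -mulrDl; congr (_ / _).
rewrite !mulrBr -!expfzDr // intS.
have -> : 1 + r%:Z + (n - r%:Z) = n + 1 by ring.
have -> : r%:Z - n + (1 + r%:Z) = 1 + r%:Z - (n - r%:Z) by ring.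
have -> : r%:Z - n - (1 + r%:Z) = - (n + 1) by ring.
by rewrite addrA subrK.
Qed.

Lemma qfact0 v : qfact v 0 = 1.
Proof. by rewrite /qfact big_geq. Qed.

Lemma qfactS v n : qfact v n.+1 = qfact v n * qint v n.+1%:Z.
Proof. by rewrite /qfact big_nat_recr. Qed.

Local Opaque qint qfact.

Lemma qbinom0 v n : qbinom v n 0%N = 1.
Proof. by rewrite /qbinom big_geq // qfact0 divr1. Qed.

Lemma qbinom_succ v (n : int) (r : nat) : v != 0 -> generic v ->
  qbinom v (n + 1) r.+1%:Z =
    v ^ r.+1%:Z * qbinom v n r.+1%:Z + v ^ (r%:Z - n) * qbinom v n r%:Z.
Proof.
move=> v0 gv; rewrite /qbinom.
rewrite qfactS big_nat_recl // subr0 big_nat_recr //=.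
rewrite (eq_bigr (fun i => qint v (n - i%:Z))); last first.
  by move=> i _; congr qint; rewrite intS; ring.
rewrite (qint_succ _ _ r) //.
(* All three numerators contain [P] = [n]...[n-r+1]; the Pascal rule is [qint_succ] multiplied by
   it. *)
set P := \prod_(_ <= _ < _) _.
have := qintS_neq0 _ r v0 gv; have := qfact_neq0 _ r v0 gv.
move: (qfact v r) (qint v r.+1%:Z) (qint v (n - r%:Z)) P => a b d P a0 b0.
rewrite !mulrDl -!mulrA; congr (_ + _ * _); first by rewrite (mulrCA d P).
by rewrite mulrA (mulrC b P) -mulf_div divff ?mulr1.
Qed.

Arguments qbinom : simpl never.

Lemma qbinom_small v (n : nat) : qbinom v n n.+1%:Z = 0.
Proof. by rewrite /qbinom big_nat_recr //= subrr qint0 mulr0 mul0r. Qed.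

(** By the Pascal rule, passing from [n] to [n + 1] multiplies the sum by [1 - v ^ (-2n)]. This
    factor vanishes at [n = 0], which starts the induction. *)
Lemma qbinom_alt_sum v (l : nat) : v != 0 -> generic v -> (0 < l)%N ->
  \sum_(t < l.+1) (-1) ^+ t * v ^ (- t%:Z * (l%:Z - 1)) * qbinom v l t%:Z = 0.
Proof.
move=> v0 gv; elim: l => // n IH _.
rewrite intS [1 + n%:Z]addrC addrK.
pose g t := (-1) ^+ t * v ^ (- t%:Z * (n%:Z - 1)) * qbinom v n t%:Z.
suff -> : \sum_(t < n.+2) (-1) ^+ t * v ^ (- t%:Z * n%:Z) * qbinom v (n%:Z + 1) t%:Z
  = (1 - v ^ (- (2 * n%:Z))) * \sum_(t < n.+1) g t.
  case: n IH @g => [|n] IH g; last by rewrite IH // mulr0.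
  by rewrite mulr0 oppr0 expr0z subrr mul0r.
have step t : (-1) ^+ t.+1 * v ^ (- t.+1%:Z * n%:Z) * qbinom v (n%:Z + 1) t.+1%:Z
  = g t.+1 - v ^ (- (2 * n%:Z)) * g t.
  rewrite qbinom_succ // /g mulrDr.
  move: (qbinom v n t.+1%:Z) (qbinom v n t%:Z) => X Y; congr (_ + _).
    rewrite mulrA; congr (_ * _); rewrite -mulrA -expfzDr //; congr (_ * v ^ _).
    by ring.
  rewrite !mulrA -mulNr; congr (_ * _).
  rewrite exprS mulN1r !mulNr; congr (- _); rewrite (mulrC _ ((-1) ^+ t)).
  rewrite -!mulrA -!expfzDr //; congr (_ * v ^ _).
  by rewrite intS; ring.
rewrite big_ord_recl (eq_bigr _ (fun (i : 'I_n.+1) _ => step i)).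
rewrite sumrB -mulr_sumr mulrBl mul1r addrA; congr (_ - _).
(* The top term [g n.+1] is 0, so the first term 1 = [g 0] and the shifted sum make up the full sum
   of [g]. *)
rewrite big_ord_recr /= {2}/g qbinom_small mulr0 addr0 big_ord_recl.
by rewrite /g /= !qbinom0 !oppr0 !mul0r expr0 !mul1r.
Qed.


(** * Convolutions and the recurrences in N *)

Definition shift (f : nat -> Qq) (n : nat) : Qq := if n is m.+1 then f m else 0.

Definition conv (f g : nat -> Qq) (n : nat) : Qq :=
  \sum_(i < n.+1) f i * g (n - i)%N.

Lemma convC f g n : conv f g n = conv g f n.
Proof.
rewrite /conv (reindex_inj rev_ord_inj) /=; apply: eq_bigr => i _.
by rewrite subSS subKn 1?mulrC // -ltnS.
Qed.

Lemma conv_shiftl f g n : conv (shift f) g n = shift (conv f g) n.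
Proof.
rewrite /conv big_ord_recl mul0r add0r.
by case: n => [|n] /=; [rewrite big_ord0 | apply: eq_bigr].
Qed.

Lemma eq_conv f f' g g' n : f =1 f' -> g =1 g' -> conv f g n = conv f' g' n.
Proof. by move=> ef eg; apply: eq_bigr => i _; rewrite ef eg. Qed.

(** In generating series [conv] is the product, [shift] is multiplication by z, and the weight
    [x ^+ i] substitutes xz for z: both sides are coefficients of ((1 + z) f g)(xz). *)
Lemma conv_scale_shift x f g n :
  conv (fun i => x ^+ i * (f i + shift f i)) (fun i => x ^+ i * g i) n =
    x ^+ n * (conv f g n + shift (conv f g) n).
Proof.
rewrite -conv_shiftl /conv -big_split mulr_sumr; apply: eq_bigr => i _ /=.
have i_le : (i <= n)%N by rewrite -ltnS.
by rewrite mulrACA -exprD subnKC // mulrDl.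
Qed.

Lemma conv_shift_scale x f g n :
  conv (fun i => x ^+ i * f i) (fun i => x ^+ i * (g i + shift g i)) n =
    x ^+ n * (conv f g n + shift (conv f g) n).
Proof.
rewrite convC conv_scale_shift convC; congr (_ * (_ + _)).
by case: n => [|n] //=; rewrite convC.
Qed.

(* The scaling by v^(rn) turns the Pascal rule into a recurrence whose
   coefficients do not depend on n. *)
Definition sbinom v (n : int) (r : nat) : Qq := v ^ (r%:Z * n) * qbinom v n r%:Z.

Lemma sbinom0 v n : sbinom v n 0 = 1.
Proof. by rewrite /sbinom mul0r expr0z mul1r qbinom0. Qed.

Lemma sbinom_succ v n r : v != 0 -> generic v ->
  sbinom v (n + 1) r = v ^+ (2 * r) * (sbinom v n r + v^-1 * shift (sbinom v n) r).
Proof.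
move=> v0 gv; case: r => [|r].
  by rewrite !sbinom0 muln0 expr0 mulr0 addr0 mulr1.
rewrite /sbinom /=.
rewrite qbinom_succ // mulrDr [RHS]mulrDr.
move: (qbinom v n _) (qbinom v n _) => X Y.
rewrite -exprN1 -[v ^+ _]/(v ^ (2 * r.+1)%N%:Z) !mulrA -!expfzDr //.
by congr (v ^ _ * _ + v ^ _ * _); rewrite PoszM intS; ring.
Qed.

Lemma q2_neq0 : q_ind ^+ 2 != 0.
Proof. by rewrite expf_neq0 // q_ind_neq0. Qed.

Lemma q2_generic : generic (q_ind ^+ 2).
Proof. by apply: generic_expr q_ind_generic. Qed.

(** With v = q^2, half of the factor [v ^+ (2 * r)] in [sbinom_succ] goes inside, where it absorbs
    [v^-1] and leaves the weights of [inner]. *)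
Lemma sbinom_q2_succ n r (f := fun i => (q_ind ^+ 2) ^+ i * sbinom (q_ind ^+ 2) n i) :
  sbinom (q_ind ^+ 2) (n + 1) r = (q_ind ^+ 2) ^+ r * (f r + shift f r).
Proof.
rewrite sbinom_succ ?q2_neq0 //; last exact: q2_generic.
rewrite mul2n -addnn exprD -[LHS]mulrA mulrDr; congr (_ * (_ + _)).
case: r => [|r] /=; first by rewrite !mulr0.
by rewrite mulrA exprSr mulfK // q2_neq0.
Qed.

(* B_s(M): the factor q^(2c) or q^(2e) moves from one argument to the other when
   the parity of M changes, which makes the recurrence uniform in M. *)
Definition inner p1 p2 (M : int) (s : nat) : Qq :=
  let A := sbinom (q_ind ^+ 2) in
  if (2 %| M)%Z
  then conv (fun c => (q_ind ^+ 2) ^+ c * A ((M %/ 2)%Z + p1) c) (A ((M %/ 2)%Z + p2)) s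
  else conv (A (1 + ((M - 1) %/ 2)%Z + p1))
            (fun e => (q_ind ^+ 2) ^+ e * A (((M - 1) %/ 2)%Z + p2) e) s.

(** Only one binomial has its top raised: the second for odd [M], the first for even [M]. It loses
    its weight by [sbinom_q2_succ] while the other gains one, so the convolution rules apply. *)
Lemma inner_succ p1 p2 M s :
  inner p1 p2 (M + 1) s =
    (q_ind ^+ 2) ^+ s * (inner p1 p2 M s + shift (inner p1 p2 M) s).
Proof.
rewrite /inner; case: ifP => ev1; case: ifP => ev; try lia.
- have -> : ((M + 1) %/ 2)%Z = ((M - 1) %/ 2)%Z + 1 by lia.
  rewrite -conv_shift_scale; apply: eq_conv => i.
    by congr (_ * sbinom _ _ _); ring.
  by rewrite addrAC sbinom_q2_succ.
- rewrite -conv_scale_shift addrK; apply: eq_conv => i //.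
  by rewrite -addrA addrC sbinom_q2_succ.
Qed.

(* This is q^(2uN) H(N). *)
Definition outer p0 p1 p2 (u : nat) (N : int) : Qq :=
  \sum_(r < u.+1) (-1) ^+ r * q_ind ^ (- (u - r)%N%:Z ^+ 2) *
    sbinom q_ind (N + p0) r * inner p1 p2 (N - r%:Z) (u - r)%N.

Lemma outer_succ p0 p1 p2 u N :
  outer p0 p1 p2 u (N + 1) = q_ind ^+ (2 * u) * outer p0 p1 p2 u N.
Proof.
rewrite /outer.
pose q := q_ind; pose A := sbinom q (N + p0).
pose B r := inner p1 p2 (N - r%:Z).
(* The exponent [2u] is 2r from the recurrence of A plus 2(u - r) from that of B. *)
pose k r := (-1) ^+ r * q ^ (2 * u%:Z - (u - r)%N%:Z ^+ 2).
have q0 : q != 0 by exact: q_ind_neq0.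
(* B is expanded only next to [A r]; next to [shift A r] it stays at [N + 1 - r], ready for the
   cancellation. *)
have step (r : 'I_u.+1) :
    (-1) ^+ r * q ^ (- (u - r)%N%:Z ^+ 2) * sbinom q (N + 1 + p0) r
      * inner p1 p2 (N + 1 - r%:Z) (u - r)%N
  = k r * A r * B r (u - r)%N + (k r * A r * shift (B r) (u - r)%N
    + (-1) ^+ r * q ^ (2 * r%:Z - 1 - (u - r)%N%:Z ^+ 2) * shift A r
      * inner p1 p2 (N + 1 - r%:Z) (u - r)%N).
  rewrite (addrAC N 1 p0) (addrAC N 1 (- r%:Z)).
  rewrite (sbinom_succ _ _ _ q0 q_ind_generic).
  have := inner_succ p1 p2 (N - r%:Z) (u - r).
  have ek : k r = (-1) ^+ r * q ^ (- (u - r)%N%:Z ^+ 2) * q ^+ (2 * r) * (q ^+ 2) ^+ (u - r).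
    rewrite /k -!mulrA; congr (_ * _).
    rewrite -exprM -[q ^+ (2 * r)]/(q ^ _%:Z) -[q ^+ _]/(q ^ _%:Z) -!expfzDr //.
    congr (q ^ _); have := ltn_ord r; lia.
  have -> : q ^ (2 * r%:Z - 1 - (u - r)%N%:Z ^+ 2) =
      q ^ (- (u - r)%N%:Z ^+ 2) * q ^+ (2 * r) * q^-1.
    rewrite -[q ^+ _]/(q ^ _%:Z) -exprN1 -!expfzDr //; congr (q ^ _).
    by rewrite PoszM; ring.
  rewrite /A /B; move: (sbinom q _ r) (shift (sbinom q _) r) ek.
  move: (inner p1 p2 _ _) (inner p1 p2 _ _) (shift (inner p1 p2 _) _).
  move: (k r) ((-1) ^+ r) (q ^ _) (q ^+ (2 * r)) ((q ^+ 2) ^+ _) q^-1.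
  by move=> K s Q V W q' i c d a b -> ->; ring.
rewrite (eq_bigr _ (fun r _ => step r)) big_split /= -[RHS]addr0; congr (_ + _).
  rewrite mulr_sumr; apply: eq_bigr => r _.
  have -> : k r = q ^+ (2 * u) * ((-1) ^+ r * q ^ (- (u - r)%N%:Z ^+ 2)).
    by rewrite mulrCA -[q ^+ _]/(q ^ _%:Z) -expfzDr.
  by rewrite /A /B; move: (sbinom _ _ _) (inner _ _ _ _) => a b; rewrite !mulrA.
(* The shifted B vanishes at r = u and the shifted A at r = 0; the other terms pair r with r + 1. *)
rewrite big_split /= big_ord_recr /= subnn mulr0 addr0.
rewrite [X in _ + X]big_ord_recl /= mulr0 mul0r add0r -big_split big1 // => r _ /=.
rewrite (_ : N + 1 - r.+1%:Z = N - r%:Z); last by rewrite intS; ring.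
rewrite (_ : (u - r)%N = (u - r.+1).+1); last by have := ltn_ord r; lia.
(* With s = u - r, 2r + 1 - (s - 1)^2 = 2u - s^2. *)
have ek : (-1) ^+ r.+1 * q ^ (2 * r.+1%:Z - 1 - (u - r.+1)%N%:Z ^+ 2) = - k r.
  rewrite /k exprS mulN1r mulNr; congr (- (_ * q ^ _)).
  have := ltn_ord r; rewrite !expr2; nia.
rewrite /= ek /bump /= -/(B r); move: (k r) (A r) (B r _) => K a b.
by rewrite !mulNr subrr.
Qed.

Lemma outer_addn p0 p1 p2 u N t :
  outer p0 p1 p2 u (N + t%:Z) = q_ind ^+ (2 * u * t) * outer p0 p1 p2 u N.
Proof.
elim: t => [|t IH]; first by rewrite addr0 muln0 mul1r.
by rewrite intS addrCA addrC outer_succ IH mulrA -exprD mulnS.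
Qed.

(** * Matching [G] with the factored sum *)

Lemma sum_triples (u : nat) (E : nat -> nat -> nat -> Qq) :
  \sum_(c < u.+1) \sum_(e < u.+1) \sum_(r < u.+1 | (c + e + r == u)%N) E c e r =
  \sum_(r < u.+1) \sum_(c < (u - r).+1) E c (u - r - c)%N r.
Proof.
under eq_bigr do under eq_bigr do rewrite big_mkcond.
under eq_bigr do rewrite exchange_big.
rewrite exchange_big; apply: eq_bigr => r _ /=.
have ur : (u - r < u.+1)%N by lia.
rewrite (big_ord_widen u.+1 (fun c => E c (u - r - c)%N r)) // [RHS]big_mkcond.
apply: eq_bigr => c _.
case: ifP => cr; last by rewrite big1 // => e _; case: eqP => //; lia.
have lt_e : (u - r - c < u.+1)%N by lia.
rewrite (bigD1 (Ordinal lt_e)) //= big1 ?addr0 => [|e ne].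
  by case: eqP => //; have := ltn_ord r; lia.
case: eqP => // h; case/eqP: ne; apply: val_inj => /=; have := ltn_ord r; lia.
Qed.

(** Separate indices [c] and [e] keep truncated subtraction out of [G_term]. *)
Definition inner_term p1 p2 (M : int) (c e : nat) : Qq :=
  let A := sbinom (q_ind ^+ 2) in
  if (2 %| M)%Z
  then (q_ind ^+ 2) ^+ c * A ((M %/ 2)%Z + p1) c * A ((M %/ 2)%Z + p2) e
  else A (1 + ((M - 1) %/ 2)%Z + p1) c * ((q_ind ^+ 2) ^+ e * A (((M - 1) %/ 2)%Z + p2) e).

Lemma innerE p1 p2 M s : inner p1 p2 M s = \sum_(c < s.+1) inner_term p1 p2 M c (s - c)%N.
Proof. by rewrite /inner /inner_term; case: ifP. Qed.

Lemma exprN1_even (M : int) : (2 %| M)%Z -> (-1 : Qq) ^ M = 1.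
Proof.
move=> ev; have -> : M = 2 * (M %/ 2)%Z by lia.
by rewrite -exprz_exp -[_ ^ 2%:Z]/((-1) ^+ 2) sqrrN expr1n exp1rz.
Qed.

(** The last factor is the sign between the two sums of [G], which therefore merge into one. *)
Lemma exprN1_add (w : int) (t r : nat) :
  (-1) ^ w = (-1) ^+ t * (-1) ^+ r * (if (2 %| w + t%:Z - r%:Z)%Z then 1 else -1) :> Qq.
Proof.
have N1 : (-1 : Qq) != 0 by rewrite oppr_eq0 oner_eq0.
rewrite -[_ ^+ t]/(_ ^ t%:Z) -[_ ^+ r]/(_ ^ r%:Z) -expfzDr //.
case: ifP => ev.
  have [k ek ->] : exists2 k, (2 %| k)%Z & w = t%:Z + r%:Z + k.
    by exists (w - t%:Z - r%:Z); [lia | ring].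
  by rewrite expfzDr // (exprN1_even _ ek) mulr1.
have [k ek ->] : exists2 k, (2 %| k)%Z & w = t%:Z + r%:Z + k + 1.
  by exists (w - t%:Z - r%:Z - 1); [lia | ring].
by rewrite !expfzDr // expr1z (exprN1_even _ ek) mulr1.
Qed.

Lemma G_term (w p0 p1 p2 : int) (l u c e r t : nat) (q := q_ind) : (c + e + r = u)%N ->
  (-1) ^ w * q ^ (u%:Z ^+ 2 - w * u%:Z + l%:Z * u%:Z) *
  (if (2 %| t%:Z + w - r%:Z)%Z then
        q ^ (- t%:Z * (l%:Z + u%:Z - 1) - u%:Z * (c%:Z + e%:Z) + 2 * c%:Z
             + r%:Z * p0 + 2 * c%:Z * p1 + 2 * e%:Z * p2)
        * qbinom q l%:Z t%:Z
        * qbinom q (w + t%:Z + p0) r%:Z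
        * qbinom (q ^+ 2) (((w + t%:Z - r%:Z) %/ 2)%Z + p1) c%:Z
        * qbinom (q ^+ 2) (((w + t%:Z - r%:Z) %/ 2)%Z + p2) e%:Z
   else
     - (q ^ (- t%:Z * (l%:Z + u%:Z - 1) - (u%:Z - 1) * (c%:Z + e%:Z)
             + r%:Z * p0 + 2 * c%:Z * p1 + 2 * e%:Z * p2)
        * qbinom q l%:Z t%:Z
        * qbinom q (w + t%:Z + p0) r%:Z
        * qbinom (q ^+ 2) (1 + ((w + t%:Z - r%:Z - 1) %/ 2)%Z + p1) c%:Z
        * qbinom (q ^+ 2) (((w + t%:Z - r%:Z - 1) %/ 2)%Z + p2) e%:Z)) =
  q ^ (u%:Z ^+ 2 + l%:Z * u%:Z) * ((-1) ^+ t * q ^ (- t%:Z * (l%:Z - 1)) * qbinom q l t%:Z)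
  * (q ^ (- (2 * u%:Z * (w + t%:Z))) *
     ((-1) ^+ r * q ^ (- (c + e)%N%:Z ^+ 2) * sbinom q (w + t%:Z + p0) r *
      inner_term p1 p2 (w + t%:Z - r%:Z) c e)).
Proof.
move=> ceru; have q0 : q != 0 by exact: q_ind_neq0.
have q2X k : (q ^+ 2) ^ k = q ^ (2 * k) by rewrite -exprz_exp.
rewrite (exprN1_add w t r) [t%:Z + w]addrC /inner_term /sbinom -/q.
rewrite -[_ ^+ c]/(_ ^ c%:Z) -[_ ^+ e]/(_ ^ e%:Z) !q2X.
move: ((-1) ^+ t) ((-1) ^+ r) => st sr.
have uE : u%:Z = c%:Z + e%:Z + r%:Z by rewrite -ceru !PoszD.
case: ifP => ev.
- have mE := divzK ev; set m := (_ %/ 2)%Z in mE *.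
  (* The [b]s are binomials, the [x]s powers of q: only an equality of exponents remains, checked
     after eliminating [u] and [w]. *)
  have shape (x y b1 b2 b3 b4 x1 x2 x3 x4 x5 x6 x7 x8 : Qq) :
      x * y = x1 * x2 * x3 * x4 * x5 * x6 * x7 * x8 ->
      st * sr * 1 * x * (y * b1 * b2 * b3 * b4) =
      x1 * (st * x2 * b1) *
        (x3 * (sr * x4 * (x5 * b2) * (x6 * (x7 * b3) * (x8 * b4)))).
    move=> eq_x; transitivity (st * sr * b1 * b2 * b3 * b4 * (x * y)); first by ring.
    by rewrite eq_x; ring.
  apply: shape; rewrite -!expfzDr //; congr (q ^ _); rewrite PoszD uE.
  have -> : w = m * 2 + r%:Z - t%:Z by rewrite mE; ring.
  by ring.
- have mE : ((w + t%:Z - r%:Z - 1) %/ 2)%Z * 2 = w + t%:Z - r%:Z - 1 by lia.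
  set m := (_ %/ 2)%Z in mE *.
  have shape (x y b1 b2 b3 b4 x1 x2 x3 x4 x5 x6 x7 x8 : Qq) :
      x * y = x1 * x2 * x3 * x4 * x5 * x6 * x7 * x8 ->
      st * sr * -1 * x * - (y * b1 * b2 * b3 * b4) =
      x1 * (st * x2 * b1) *
        (x3 * (sr * x4 * (x5 * b2) * (x6 * b3 * (x7 * (x8 * b4))))).
    move=> eq_x; transitivity (st * sr * b1 * b2 * b3 * b4 * (x * y)); first by ring.
    by rewrite eq_x; ring.
  apply: shape; rewrite -!expfzDr //; congr (q ^ _); rewrite PoszD uE.
  have -> : w = m * 2 + r%:Z - t%:Z + 1 by rewrite mE; ring.
  by ring.
Qed.

Theorem theorem5p6 (w p0 p1 p2 : int) (l u : nat) (hl : (0 < l)%N) :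
  G w u l p0 p1 p2 = 0.
Proof.
pose q := q_ind; have q0 : q != 0 by exact: q_ind_neq0.
pose K t := q ^ (u%:Z ^+ 2 + l%:Z * u%:Z) *
  ((-1) ^+ t * q ^ (- t%:Z * (l%:Z - 1)) * qbinom q l t%:Z).
pose E t c e r := K t * (q ^ (- (2 * u%:Z * (w + t%:Z))) *
     ((-1) ^+ r * q ^ (- (c + e)%N%:Z ^+ 2) * sbinom q (w + t%:Z + p0) r *
      inner_term p1 p2 (w + t%:Z - r%:Z) c e)).
transitivity (\sum_(c < u.+1) \sum_(e < u.+1) \sum_(r < u.+1 | (c + e + r == u)%N)
    \sum_(t < l.+1) E t c e r).
  rewrite /G -sumrB mulr_sumr; apply: eq_bigr => c _.
  rewrite -sumrB mulr_sumr; apply: eq_bigr => e _.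
  rewrite -sumrB mulr_sumr; apply: eq_bigr => r /eqP cer.
  rewrite big_mkcond [X in _ * (_ - X)]big_mkcond -sumrB mulr_sumr; apply: eq_bigr => t _.
  rewrite /E /K -G_term //; congr (_ * _).
  by case: ifP => _; rewrite ?subr0 ?sub0r.
rewrite (sum_triples u (fun c e r => \sum_(t < l.+1) E t c e r)).
(* Moving from [w] to [w + t] multiplies [outer] by q^(2ut), which the prefactor cancels; only [K t]
   depends on [t]. *)
have outer_const t : \sum_(r < u.+1) \sum_(c < (u - r).+1) E t c (u - r - c)%N r =
    K t * (q ^ (- (2 * u%:Z * w)) * outer p0 p1 p2 u w).
  have -> : q ^ (- (2 * u%:Z * w)) * outer p0 p1 p2 u w =
      q ^ (- (2 * u%:Z * (w + t%:Z))) * outer p0 p1 p2 u (w + t%:Z).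
    rewrite outer_addn mulrA -[q_ind ^+ _]/(q ^ _%:Z) -expfzDr //; congr (q ^ _ * _).
    by rewrite !PoszM; ring.
  rewrite /outer !mulr_sumr; apply: eq_bigr => r _.
  rewrite innerE !mulr_sumr; apply: eq_bigr => c _; rewrite /E subnKC //.
  by rewrite -ltnS.
under eq_bigr do rewrite exchange_big.
rewrite exchange_big (eq_bigr _ (fun (t : 'I_l.+1) _ => outer_const t)) -mulr_suml.
rewrite /K -mulr_sumr (qbinom_alt_sum _ _ q0 q_ind_generic hl).
by rewrite mulr0 mul0r.
Qed.
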